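(* The class $\mathcal D_c^{\mathcal P}$ of bounded directoids with an antitone involution canonically assigned to the class of paraorthomodular posets forms a quasivariety. It is axiomatized, relative to bounded commutative directoids with a unary operation ${}'$, by the identities $x''\approx x$ and $(x\sqcap y)'\sqcap y'\approx y'$ and the quasi-identity $$(x\sqcap y)'\sqcap y=0\ \text{ implies }\ x\sqcap y=y.$$
   Context: A commutative directoid is a groupoid $(D,\sqcap)$ satisfying $x\sqcap x\approx x$, $x\sqcap y\approx y\sqcap x$ and $(x\sqcap(y\sqcap z))\sqcap z\approx x\sqcap(y\sqcap z)$. Its induced order is: $x\leq y$ iff $x\sqcap y=x$. It is bounded by constants $0,1$ if these are the least and greatest elements of the induced order (i.e. $x\sqcap0\approx0$, $x\sqcap1\approx x$). A bounded directoid with an antitone involution is an algebra $(D,\sqcap,{}',0,1)$ that is a bounded commutative directoid with ${}'$ an antitone involution of the induced order. A bounded poset $(P,\leq,{}',0,1)$ with an antitone involution ($x''=x$; $x\leq y$ implies $y'\leq x'$) is paraorthomodular if for all $x,y$: $x\leq y$ and $L(x',y)=\{0\}$ imply $x=y$, where $L(a,b)=\{z\mid z\leq a,\ z\leq b\}$. A bounded directoid $(P,\sqcap,{}',0,1)$ with an antitone involution is canonically assigned to a bounded poset $\mathbf P=(P,\leq,{}',0,1)$ with an antitone involution if $\sqcap$ is commutative and, for all $x,y\in P$: $x\sqcap y=\min\{x,y\}$ if $x,y$ are comparable; otherwise, if $x'<y$ and $L(x,y)\neq\{0\}$, $x\sqcap y$ is an arbitrary element of $L(x,y)\setminus\{0\}$;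 otherwise $x\sqcap y$ is an arbitrary element of $L(x,y)$. $\mathcal D_c^{\mathcal P}$ is the class of all bounded directoids with an antitone involution canonically assigned to some paraorthomodular poset. *)

(* Defs.v *)
From Stdlib Require Import Relation_Definitions.
From mathcomp Require Import ssreflect ssrfun ssrbool eqtype ssrnat seq.
From mathcomp Require Import classical_sets.

Set Implicit Arguments.
Unset Strict Implicit.
Unset Printing Implicit Defensive.

Local Open Scope classical_set_scope.

Record algebra : Type := Algebra {
  carrier :> Type;
  meet : carrier -> carrier -> carrier;
  neg : carrier -> carrier;
  zero : carrier;
  one : carrier
}.
Arguments zero : clear implicits.
Arguments one : clear implicits.

Declare Scope algebra_scope.
Delimit Scope algebra_scope with alg.
Notation "x ⊓ y" := (meet x y) (at level 40, left associativity) : algebra_scope.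
Local Open Scope algebra_scope.

Inductive term : Type :=
| Var of nat
| Meet of term & term
| Neg of term
| Zero
| One.

Declare Scope term_scope.
Delimit Scope term_scope with term.
Bind Scope term_scope with term.
Notation "s ⊓ t" := (Meet s t) (at level 40, left associativity) : term_scope.

Fixpoint eval (A : algebra) (v : nat -> A) (t : term) : A :=
  match t with
  | Var n => v n
  | Meet s t => eval v s ⊓ eval v t
  | Neg t => neg (eval v t)
  | Zero => zero A
  | One => one A
  end.

Record equation : Type := Equation { lhs : term; rhs : term }.
Notation "s ≈ t" := (Equation s%term t%term) (at level 70, no associativity).

Record quasi_identity : Type := QuasiIdentity {
  premises : seq equation;
  conclusion : equation
}.

Definition identity (e : equation) : quasi_identity := QuasiIdentity [::] e.

Definition holds (A : algebra) (v : nat -> A) (e : equation) : Prop :=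
  eval v (lhs e) = eval v (rhs e).

Fixpoint holds_all (A : algebra) (v : nat -> A) (es : seq equation) : Prop :=
  match es with
  | [::] => True
  | e :: es => holds v e /\ holds_all v es
  end.

Definition satisfies (A : algebra) (q : quasi_identity) : Prop :=
  forall v : nat -> A, holds_all v (premises q) -> holds v (conclusion q).

Definition models (A : algebra) (Q : set quasi_identity) : Prop :=
  forall q, Q q -> satisfies A q.

Definition quasivariety (K : algebra -> Prop) : Prop :=
  exists Q : set quasi_identity, forall A : algebra, K A <-> models A Q.

Definition induced_le (A : algebra) : relation A := fun x y => x ⊓ y = x.

Record commutative_directoid (A : algebra) : Prop := {
  meet_idem : forall x : A, x ⊓ x = x;
  meet_comm : forall x y : A, x ⊓ y = y ⊓ x;
  meet_weak_assoc : forall x y z : A, (x ⊓ (y ⊓ z)) ⊓ z = x ⊓ (y ⊓ z)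
}.

Record bounded_commutative_directoid (A : algebra) : Prop := {
  bcd_directoid : commutative_directoid A;
  bcd_least : forall x : A, induced_le (zero A) x;
  bcd_greatest : forall x : A, induced_le x (one A)
}.

Definition antitone_involution (P : Type) (le : relation P) (c : P -> P) : Prop :=
  (forall x, c (c x) = x) /\ (forall x y, le x y -> le (c y) (c x)).

Definition bounded_directoid_with_antitone_involution (A : algebra) : Prop :=
  bounded_commutative_directoid A /\
  antitone_involution (@induced_le A) (@neg A).

Record bounded_poset_with_antitone_involution
    (P : Type) (le : relation P) (c : P -> P) (bot top : P) : Prop := {
  poset_order : order P le;
  poset_least : forall x, le bot x;
  poset_greatest : forall x, le x top;
  poset_involution : antitone_involution le c
}.

Definition lower_cone (P : Type) (le : relation P) (a b : P) : set P :=
  [set z | le z a /\ le z b].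

Record paraorthomodular_poset
    (P : Type) (le : relation P) (c : P -> P) (bot top : P) : Prop := {
  paraorthomodular_bounded :
    bounded_poset_with_antitone_involution le c bot top;
  paraorthomodularity :
    forall x y, le x y -> lower_cone le (c x) y = [set bot] -> x = y
}.

Definition comparable (P : Type) (le : relation P) (x y : P) : Prop :=
  le x y \/ le y x.

Definition strict (P : Type) (le : relation P) (x y : P) : Prop :=
  le x y /\ x <> y.

(* The poset shares its carrier, its involution and its bounds with [A], so only
   its order is a parameter.  That [le] is the induced order of [A] is not
   required; it follows from the clauses on [⊓]. *)
Record canonically_assigned (A : algebra) (le : relation A) : Prop := {
  assigned_directoid : bounded_directoid_with_antitone_involution A;
  assigned_min_l : forall x y : A, le x y -> x ⊓ y = x;
  assigned_min_r : forall x y : A, le y x -> x ⊓ y = y;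
  assigned_nonzero : forall x y : A, ~ comparable le x y ->
    strict le (neg x) y /\ lower_cone le x y <> [set zero A] ->
    (lower_cone le x y `\ zero A) (x ⊓ y);
  assigned_otherwise : forall x y : A, ~ comparable le x y ->
    ~ (strict le (neg x) y /\ lower_cone le x y <> [set zero A]) ->
    lower_cone le x y (x ⊓ y)
}.

Definition DcP (A : algebra) : Prop :=
  exists le : relation A,
    paraorthomodular_poset le (@neg A) (zero A) (one A) /\
    canonically_assigned le.

Local Notation x := (Var 0).
Local Notation y := (Var 1).

Definition double_neg_axiom : quasi_identity :=
  identity (Neg (Neg x) ≈ x).

Definition antitone_axiom : quasi_identity :=
  identity (Neg (x ⊓ y) ⊓ Neg y ≈ Neg y).

Definition paraorthomodular_axiom : quasi_identity :=
  QuasiIdentity [:: Neg (x ⊓ y) ⊓ y ≈ Zero] (x ⊓ y ≈ y).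

(* Main.v *)
From Stdlib Require Import Relation_Definitions Classical.
From mathcomp Require Import ssreflect ssrfun ssrbool seq.
From mathcomp Require Import classical_sets.
Require Import Defs.

(** The order [le] of a poset to which an algebra is canonically assigned is the
    induced order of the algebra: [x ⊓ y] is always a common lower bound of [x]
    and [y] ([assigned_lower_cone]), and it is the smaller of the two when they
    are comparable. So membership in [DcP] is a property of the directoid alone:
    its induced order is paraorthomodular, and [x ⊓ y <> 0] for incomparable
    [x], [y] with [x' < y] and [L(x, y) <> {0}]. The quasi-identity is equivalent
    to these two properties together.

    The elements [a = x ⊓ y] and [y] in the quasi-identity form an arbitrary
    pair with [a ≤ y]. Paraorthomodularity concludes [a = y] from
    [L(a', y) = {0}], the quasi-identity from the formally weaker [a' ⊓ y = 0].
    The two premises differ only if [⊓] picks [0] although [L(a', y)] has nonzero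
    elements. For [a < y] the pair [a', y] is of the form [u' < y], which is where
    a canonical assignment forbids that choice; this gives the quasi-identity
    ([assigned_quasi_identity]). Conversely, the quasi-identity gives
    paraorthomodularity at once, and, read contrapositively at
    [a = u'], it says that [u' < y] forces [u ⊓ y <> 0], which is the restriction
    on the choice ([axioms_DcP]).

    The axioms of bounded commutative directoids are identities, so the
    axiomatization exhibits [DcP] as a quasivariety. *)

Local Open Scope classical_set_scope.
Local Open Scope algebra_scope.

Section Directoid.

Variable A : algebra.
Hypothesis dirA : bounded_commutative_directoid A.

Let compat := bcd_directoid dirA.

Lemma induced_le_meetr (x y : A) : induced_le (x ⊓ y) y.
Proof.
by have := meet_weak_assoc compat x y y; rewrite (meet_idem compat).
Qed.

Lemma induced_le_meetl (x y : A) : induced_le (x ⊓ y) x.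
Proof. by rewrite (meet_comm compat); apply: induced_le_meetr. Qed.

Lemma lower_cone_meet (x y : A) : lower_cone (@induced_le A) x y (x ⊓ y).
Proof. by split; [apply: induced_le_meetl | apply: induced_le_meetr]. Qed.

(** Weak associativity yields transitivity: if [x ≤ y ≤ z], then
    [x ⊓ (y ⊓ z)] collapses to [x], and the law says that it lies below [z]. *)
Lemma order_induced_le : order A (@induced_le A).
Proof.
split.
- exact: meet_idem compat.
- move=> x y z xy yz.
  by have := meet_weak_assoc compat x y z; rewrite yz xy.
- by move=> x y xy yx; rewrite -xy (meet_comm compat).
Qed.

End Directoid.

Section Assigned.

Variables (A : algebra) (le : relation A).
Hypothesis pomA : paraorthomodular_poset le (@neg A) (zero A) (one A).
Hypothesis asgA : canonically_assigned le.

Let ordA := poset_order (paraorthomodular_bounded pomA).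

Lemma assigned_lower_cone (x y : A) : lower_cone le x y (x ⊓ y).
Proof.
have [[xy|yx]|ncmp] := classic (comparable le x y).
- by rewrite (assigned_min_l asgA xy); split=> //; apply: ord_refl ordA _.
- by rewrite (assigned_min_r asgA yx); split=> //; apply: ord_refl ordA _.
- have [h|h] := classic
    (strict le (neg x) y /\ lower_cone le x y <> [set zero A]).
  + by have [] := assigned_nonzero asgA ncmp h.
  + exact: assigned_otherwise asgA _ _ ncmp h.
Qed.

(** For incomparable [x] and [y] this is the restriction on the choice of
    [x ⊓ y], read contrapositively; for comparable ones the minimum, which is
    [0], bounds the lower cone. *)
Lemma assigned_meet_zero (x y : A) :
  strict le (neg x) y -> x ⊓ y = zero A -> lower_cone le x y = [set zero A].
Proof.
move=> x'y xy0; apply: NNPP => Lxy.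
have [cmp|ncmp] := classic (comparable le x y); last first.
  by have [_ /(_ xy0)] := assigned_nonzero asgA ncmp (conj x'y Lxy).
apply: Lxy; apply/seteqP; split=> z /=; last first.
  by move=> ->; rewrite -xy0; apply: assigned_lower_cone.
move=> [zx zy]; apply: (ord_antisym _ _ ordA).
  by rewrite -xy0; case: cmp => c;
    [rewrite (assigned_min_l asgA c) | rewrite (assigned_min_r asgA c)].
exact: poset_least (paraorthomodular_bounded pomA) z.
Qed.

Lemma assigned_quasi_identity (x y : A) :
  neg (x ⊓ y) ⊓ y = zero A -> x ⊓ y = y.
Proof.
have [_ le_ay] := assigned_lower_cone x y.
move: (x ⊓ y) le_ay => a le_ay a'y0; apply: NNPP => a_neq_y.
have [negK _] := poset_involution (paraorthomodular_bounded pomA).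
apply: (a_neq_y); apply: (paraorthomodularity pomA le_ay).
by apply: assigned_meet_zero a'y0; rewrite negK.
Qed.

End Assigned.

Definition val3 (A : algebra) (x y z : A) (n : nat) : A :=
  match n with 0 => x | 1 => y | _ => z end.

Lemma satisfies_double_neg (A : algebra) :
  satisfies A double_neg_axiom <-> forall x : A, neg (neg x) = x.
Proof.
by split=> [h x|h v _]; [apply: (h (val3 A x x x)) | apply: h].
Qed.

Lemma satisfies_antitone (A : algebra) :
  satisfies A antitone_axiom <->
  forall x y : A, neg (x ⊓ y) ⊓ neg y = neg y.
Proof.
by split=> [h x y|h v _]; [apply: (h (val3 A x y y)) | apply: h].
Qed.

Lemma satisfies_paraorthomodular (A : algebra) :
  satisfies A paraorthomodular_axiom <->
  forall x y : A, neg (x ⊓ y) ⊓ y = zero A -> x ⊓ y = y.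
Proof.
split=> [h x y xy0|h v [vxy0 _]]; last exact: h vxy0.
exact: (h (val3 A x y y) (conj xy0 I)).
Qed.

Lemma models_axioms (A : algebra) :
  models A [set double_neg_axiom; antitone_axiom; paraorthomodular_axiom] <->
  [/\ forall x : A, neg (neg x) = x,
      forall x y : A, neg (x ⊓ y) ⊓ neg y = neg y &
      forall x y : A, neg (x ⊓ y) ⊓ y = zero A -> x ⊓ y = y].
Proof.
split=> [h|[dn at_ pm] q [[->|->]|->]].
- split; [apply/satisfies_double_neg | apply/satisfies_antitone |
          apply/satisfies_paraorthomodular]; apply: h.
  + by left; left.
  + by left; right.
  + by right.
- exact/satisfies_double_neg.
- exact/satisfies_antitone.
- exact/satisfies_paraorthomodular.
Qed.

Local Notation x := (Var 0).
Local Notation y := (Var 1).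
Local Notation z := (Var 2).

(** The order relations [0 ≤ x] and [x ≤ 1] are themselves equations. *)
Definition directoid_axioms : set quasi_identity :=
  [set identity (x ⊓ x ≈ x)] `|`
  [set identity (x ⊓ y ≈ y ⊓ x)] `|`
  [set identity ((x ⊓ (y ⊓ z)) ⊓ z ≈ x ⊓ (y ⊓ z))] `|`
  [set identity (Zero ⊓ x ≈ Zero)] `|`
  [set identity (x ⊓ One ≈ x)].

Lemma models_directoid_axioms (A : algebra) :
  bounded_commutative_directoid A <-> models A directoid_axioms.
Proof.
split=> [[[idem comm wassoc] le0 le1] q [[[[->|->]|->]|->]|->] v _|h].
- exact: idem.
- exact: comm.
- exact: wassoc.
- exact: le0.
- exact: le1.
- split; first split.
  + move=> a; apply: (h (identity (x ⊓ x ≈ x)) _ (val3 A a a a) I).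
    by left; left; left; left.
  + move=> a b; apply: (h (identity (x ⊓ y ≈ y ⊓ x)) _ (val3 A a b b) I).
    by left; left; left; right.
  + move=> a b c.
    apply: (h (identity ((x ⊓ (y ⊓ z)) ⊓ z ≈ x ⊓ (y ⊓ z))) _
              (val3 A a b c) I).
    by left; left; right.
  + move=> a; apply: (h (identity (Zero ⊓ x ≈ Zero)) _ (val3 A a a a) I).
    by left; right.
  + move=> a; apply: (h (identity (x ⊓ One ≈ x)) _ (val3 A a a a) I).
    by right.
Qed.

Lemma DcP_axioms (A : algebra) : DcP A ->
  bounded_commutative_directoid A /\
  models A [set double_neg_axiom; antitone_axiom; paraorthomodular_axiom].
Proof.
move=> [le [pomA asgA]].
have [dirA [negK neg_anti]] := assigned_directoid asgA.
split=> //; apply/models_axioms; split=> //.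
- move=> a b; rewrite (meet_comm (bcd_directoid dirA)).
  exact: neg_anti (induced_le_meetr A dirA a b).
- exact: assigned_quasi_identity pomA asgA.
Qed.

Lemma axioms_DcP (A : algebra) : bounded_commutative_directoid A ->
  models A [set double_neg_axiom; antitone_axiom; paraorthomodular_axiom] ->
  DcP A.
Proof.
move=> dirA /models_axioms[negK neg_anti quasi].
have comm := meet_comm (bcd_directoid dirA).
have inv : antitone_involution (@induced_le A) (@neg A).
  split=> // a b ab; rewrite /induced_le comm.
  by have := neg_anti a b; rewrite ab.
have quasi_le (a b : A) : induced_le a b -> neg a ⊓ b = zero A -> a = b.
  by move=> ab a'b0; rewrite -ab; apply: quasi; rewrite ab.
exists (@induced_le A); split; split.
- split=> //; first exact: order_induced_le.
    exact: bcd_least dirA.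
  exact: bcd_greatest dirA.
- move=> a b ab La'b; apply: quasi_le ab _.
  by have := lower_cone_meet A dirA (neg a) b; rewrite La'b.
- by split.
- by [].
- by move=> a b ba; rewrite comm.
- move=> a b _ [[a'b a'_neq_b] _]; split; first exact: lower_cone_meet.
  move=> /= ab0; apply: a'_neq_b; apply: quasi_le a'b _.
  by rewrite negK.
- by move=> a b _ _; apply: lower_cone_meet.
Qed.

Theorem proposition3p10 :
  quasivariety DcP /\
  (forall A : algebra,
     DcP A <->
     bounded_commutative_directoid A /\
     models A [set double_neg_axiom; antitone_axiom; paraorthomodular_axiom]).
Proof.
have axiomatized (A : algebra) : DcP A <->
    bounded_commutative_directoid A /\
    models A [set double_neg_axiom; antitone_axiom; paraorthomodular_axiom].
  by split=> [|[dirA modA]]; [apply: DcP_axioms | apply: axioms_DcP].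
split=> //.
exists (directoid_axioms `|`
  [set double_neg_axiom; antitone_axiom; paraorthomodular_axiom]) => A.
split=> [/axiomatized[/models_directoid_axioms dirA modA] q [/dirA|/modA] //|h].
apply/axiomatized; split; first apply/models_directoid_axioms.
  by move=> q dq; apply: h; left.
by move=> q aq; apply: h; right.
Qed.
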